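(* Let $S$ be a right self-injective von Neumann regular ring and let $R$ be a subring of $S$. Assume that $R$ is stable under left multiplication by units of $S$, i.e. $ur\in R$ for every unit $u$ of $S$ and every $r\in R$. Then $R$ is also von Neumann regular. Moreover, $R=R_1\times R_2$ (a direct product decomposition of the ring $R$), where $R_1$ is an abelian regular ring and $R_2$ is a von Neumann regular right self-injective ring which is invariant under left multiplication by elements of $S$, i.e. $sr\in R_2$ for all $s\in S$ and $r\in R_2$ (with $R_2$ viewed inside $R\subseteq S$).
   Context: Rings are associative with identity, and a subring of $S$ contains the identity of $S$. A ring is abelian regular if it is von Neumann regular and all its idempotents are central. A ring $S$ is right self-injective if $S_S$ is an injective right module. *)

(* Defs.v *)
From HB Require Import structures.
From mathcomp Require Import all_boot all_order all_algebra.

Set Implicit Arguments.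
Unset Strict Implicit.
Unset Printing Implicit Defensive.

Import GRing.Theory.
Local Open Scope ring_scope.

(* Rings are pzRingType's: associative and unital, the zero ring allowed (it is
   needed because either factor of the decomposition may vanish). *)

(* GRing.unit needs a unitRingType, which excludes the zero ring. *)
Definition is_unit (A : pzRingType) (u : A) : Prop :=
  exists v : A, u * v = 1 /\ v * u = 1.

Definition von_neumann_regular (A : pzRingType) : Prop :=
  forall a : A, exists x : A, a * x * a = a.

Definition abelian_regular (A : pzRingType) : Prop :=
  von_neumann_regular A /\
  forall e : A, e * e = e -> forall x : A, GRing.comm e x.

Definition injective_module (A : pzRingType) (M : lmodType A) : Prop :=
  forall (U V : lmodType A) (i : {linear U -> V}) (f : {linear U -> M}),
    injective i -> exists g : {linear V -> M}, forall u : U, g (i u) = f u.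

(* Right A-modules are left modules over the converse ring A^c; the regular
   module (A^c)^o has action a *: x = x * a (product of A), i.e. it is A_A. *)
Definition right_self_injective (A : pzRingType) : Prop :=
  injective_module ((A^c)^o : lmodType A^c).

(* Main.v *)
(* [R] contains every unit of [S], hence every element [x] with [x * x = 0]
   (as [1 + x] is a unit), hence every ideal [S z S] with [z] in [(1 - e) S e]
   for an idempotent [e] (Peirce decomposition). A maximal isomorphism between
   two independent right ideals is, by injectivity, carried by an idempotent [e]
   and such a [z] with [e] in [S z S]; the remaining corner [h S] contains no two
   isomorphic independent right ideals. Splitting off from [h] a maximal part
   [h1] isomorphic to a submodule of [e S] leaves an idempotent [c := h - h1]
   that is central, such that all idempotents of [c S] are central, and such that
   [1 - c] lies in [S z S], so [(1 - c) S] is contained in [R]. Thus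
   [R = c R * (1 - c) S]. In [c S] each element [a] has a unit [u] of [S] with
   [a u a = a]; as [u] is in [R], this makes [R] regular. *)
Require Import Defs.
From HB Require Import structures.
From mathcomp Require Import all_boot all_order all_algebra.
From mathcomp Require Import boolp classical_sets.

Set Implicit Arguments.
Unset Strict Implicit.
Unset Printing Implicit Defensive.

Import GRing.Theory.
Local Open Scope ring_scope.

(** * Maximal submodules by Zorn's lemma *)

Definition submodule (A : pzRingType) (M : lmodType A) (G : M -> Prop) :=
  G 0 /\ forall a x y, G x -> G y -> G (a *: x + y).

(** Any two elements of the union of a chain lie in one member of it, so Zorn's lemma can handle a
    binary [q]; this allows conditions comparing two elements, such as the disjointness of a domain
    and a codomain. *)
Lemma exists_maximal_submodule (A : pzRingType) (M : lmodType A)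
    (q : M -> M -> Prop) : q 0 0 ->
  exists G : M -> Prop,
    [/\ submodule G, forall x y, G x -> G y -> q x y
      & forall G' : M -> Prop, submodule G' ->
          (forall x y, G' x -> G' y -> q x y) ->
          (forall x, G x -> G' x) -> forall x, G' x -> G x].
Proof.
move=> q0.
(* [P] does not ask for [0], because the empty chain has empty union. A maximal set without [0]
   would be empty, hence smaller than the zero submodule. *)
pose P (X : set M) := (forall a x y, X x -> X y -> X (a *: x + y)) /\
  forall x y, X x -> X y -> q x y.
have [F FP Ftot|G [[Glin Gq] Gmax]] := @Zorn_bigcup M P.
  have dir x y : (\bigcup_(X in F) X)%classic x ->
      (\bigcup_(X in F) X)%classic y -> exists X, [/\ F X, X x & X y].
    move=> [X FX Xx] [Y FY Yy].
    by case: (Ftot _ _ FX FY) => le; [exists Y | exists X]; split=> //; exact: le.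
  split=> [a x y /dir xP /xP [X [FX Xx Xy]]|x y /dir xP /xP [X [FX Xx Xy]]].
    by exists X => //; apply: (FP _ FX).1.
  exact: (FP _ FX).2.
have G0 : G 0.
  apply: contrapT => nG0.
  have Gemp x : ~ G x.
    move=> Gx; apply: nG0.
    by rewrite -(addNr x) -scaleN1r; apply: Glin.
  apply: (Gmax (fun x => x = 0)); last first.
    by split=> [a x y -> -> /=|x y -> -> //]; rewrite scaler0 addr0.
  by split=> [x /Gemp|le]; last exact: nG0 (le 0 erefl).
exists G; split=> // G' [G'0 G'lin] G'q le x G'x.
apply: contrapT => nGx; apply: (Gmax G') => //.
by split=> [//|le']; exact: nGx (le' _ G'x).
Qed.

(** * Extension of linear maps given by their graphs *)

Section GraphExtension.
Variables (S : pzRingType).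
Hypothesis S_injective : right_self_injective S.

Let M : lmodType S^c := (S^c)^o.
Variable G : (M * M)%type -> Prop.
Hypotheses (Gsub : submodule G).

Definition graph_pred : {pred (M * M)%type} := fun p => `[< G p >].

Fact graph_submod_closed : submod_closed graph_pred.
Proof.
by case: Gsub => G0 Gl; split=> [|a x y]; rewrite !unfold_in !asboolE //; exact: Gl.
Qed.
HB.instance Definition _ := GRing.isSubmodClosed.Build _ _ graph_pred
  graph_submod_closed.

Record graph := Graph { graph_val :> (M * M)%type; _ : graph_val \in graph_pred }.
HB.instance Definition _ := [isSub for graph_val].
HB.instance Definition _ := [Choice of graph by <:].
HB.instance Definition _ := [SubChoice_isSubLmodule of graph by <:].

(** The graph itself serves as source module: the first projection embeds it in [S], the second is
    the map to extend. An endomorphism of the right module [S] is left multiplication by its value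
    at [1]. *)
Lemma linear_on_graph :
  (forall y, G (0, y) -> y = 0) ->
  exists m : S, forall x y : S, G (x, y) -> y = m * x.
Proof.
move=> Gfun.
pose i : {linear graph -> M} := (fst \o val : graph -> M).
pose f : {linear graph -> M} := (snd \o val : graph -> M).
have inj_i : injective i.
  apply/raddf_inj => -[[x y] pG] /= x0; apply/val_inj => /=.
  move: pG x0; rewrite unfold_in asboolE => pG; rewrite /i /= => x0.
  by rewrite x0 in pG *; rewrite (Gfun _ pG).
have [g gP] := S_injective f inj_i.
pose m : S := g 1.
have gE (x : S) : g x = m * x.
  by rewrite -[in LHS](mul1r x); exact: (linearZ_LR g (x : S^c) (1 : S)).
exists m => x y Gxy; rewrite -gE.
have Gin : (x, y) \in graph_pred by rewrite unfold_in asboolE.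
by have /esym := gP (Graph Gin).
Qed.
End GraphExtension.

(** * Idempotents of a regular right self-injective ring *)

Section RegularSelfInjective.
Variables (S : pzRingType).
Hypothesis S_regular : von_neumann_regular S.
Hypothesis S_injective : right_self_injective S.

Definition right_ideal (A : S -> Prop) :=
  A 0 /\ forall s x y, A x -> A y -> A (x * s + y).

(* [m] extends the projection of [A + C] onto [A], where [C] is maximal among
   the right ideals that meet [A] trivially: [m] then kills no more than [C],
   so [A] is essential in the image of [m]. *)
Lemma essential_hull (h : S) (A : S -> Prop) :
  h * h = h -> right_ideal A -> (forall a, A a -> h * a = a) ->
  exists e, [/\ e * e = e, h * e = e, forall a, A a -> e * a = a
    & forall x, (forall s, A (e * x * s) -> e * x * s = 0) -> e * x = 0].
Proof.
move=> hh [A0 Al] Ah.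
have [//|C [[C0 Cl'] CA Cmax]] := @exists_maximal_submodule _
  ((S^c)^o : lmodType S^c) (fun x _ => A x -> x = 0).
have Cl (s x y : S) : C x -> C y -> C (x * s + y) := Cl' s x y.
have {Cmax} Cmax (C' : S -> Prop) : right_ideal C' ->
    (forall x, C' x -> A x -> x = 0) -> (forall x, C x -> C' x) ->
    forall x, C' x -> C x.
  by move=> sC' C'A; apply: Cmax => // x y C'x _; exact: C'A.
have AN a : A a -> A (- a).
  by move=> Aa; have := Al (- 1) _ _ Aa A0; rewrite mulrN1 addr0.
have [||m0 m0E] := @linear_on_graph S S_injective
    (fun p => exists a c : S, [/\ A a, C c & p = (a + c, a)]).
- split; first by exists 0, 0; split; rewrite // addr0.
  move=> s _ _ [a [c [Aa Cc ->]]] [b [d [Ab Cd ->]]].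
  exists (a * s + b), (c * s + d); split; [exact: Al | exact: Cl |].
  congr (_, _); transitivity ((a + c) * s + (b + d)) => //.
  by rewrite mulrDl !addrA; congr (_ + _); rewrite -!addrA (addrC b).
- move=> y [a [c [Aa Cc [/esym ac0 ->]]]].
  have ca : c = - a by apply/eqP; rewrite -addr_eq0 addrC; apply/eqP.
  have Ac : A c by rewrite ca; exact: AN.
  by move: ac0; rewrite (CA c c) // addr0.
pose m := h * m0.
have mA a : A a -> m * a = a.
  move=> Aa; rewrite -mulrA -(m0E a a) ?Ah //.
  by exists a, 0; split; rewrite // addr0.
have mC c : C c -> m * c = 0.
  move=> Cc; rewrite -mulrA -(m0E c 0) ?mulr0 //.
  by exists 0, c; split; rewrite // add0r.
have [w mwm] := S_regular m.
exists (m * w); split.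
- by rewrite mulrA mwm.
- by rewrite !mulrA hh.
- by move=> a Aa; rewrite -{1}(mA a Aa) mulrA mwm mA.
move=> x ess; rewrite -mulrA; apply: (mC _).
(* [C + w x S] still meets [A] trivially: if [c + w x s] is in [A], it is fixed by [m], so it equals
   [m w x s], which [ess] makes zero. Hence [w x] is in [C]. *)
apply: (Cmax (fun y => exists c s : S, C c /\ y = c + w * x * s)).
- split; first by exists 0, 0; rewrite mulr0 addr0.
  move=> s _ _ [c [r [Cc ->]]] [d [t [Cd ->]]].
  exists (c * s + d), (r * s + t); split; first exact: Cl.
  rewrite mulrDl mulrDr !mulrA !addrA; congr (_ + _).
  by rewrite -!addrA (addrC d).
- move=> _ [c [s [Cc ->]]] Acs.
  have mE : m * (c + w * x * s) = m * w * x * s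
    by rewrite mulrDr mC // add0r !mulrA.
  have := mA _ Acs; rewrite mE => mE'; rewrite -mE'.
  by apply: ess; rewrite mE'.
- by move=> c Cc; exists c, 0; rewrite mulr0 addr0.
- by exists 0, 1; rewrite mulr1 add0r.
Qed.

(* The partial isomorphism is [e s |-> u s], from [e S] (inside [h S]) onto [u S]
   (inside [k S]); the condition on [s] says that [x s |-> y s] is a well-defined
   isomorphism, and the last one that [x S] and [y S] extend the domain and the
   codomain directly. *)
Lemma exists_maximal_partial_iso (h k : S) : h * h = h -> k * k = k ->
  exists e u, [/\ e * e = e, h * e = e, k * u = u & u * e = u] /\
  [/\ forall s, u * s = 0 -> e * s = 0, forall s t, e * s = u * t -> e * s = 0
    & forall x y, h * x = x -> k * y = y -> (forall s, x * s = 0 <-> y * s = 0) ->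
        (forall a b c d, e * a + u * b + x * c + y * d = 0 ->
           x * c = 0 /\ y * d = 0) ->
        x = 0].
Proof.
move=> hh kk.
(* The two zero clauses make [G] the graph of an injective map; the last clause makes its domain and
   image meet only in [0]. *)
pose q (p p' : ((S^c)^o * (S^c)^o)%type) :=
  [/\ h * (p.1 : S) = p.1, k * (p.2 : S) = p.2, p.1 = 0 -> p.2 = 0,
      p.2 = 0 -> p.1 = 0 & p.1 = p'.2 -> p.1 = 0].
have [|G [Gsub Gq Gmax]] := @exists_maximal_submodule _
  (((S^c)^o * (S^c)^o)%type : lmodType S^c) q.
  by split=> //=; rewrite mulr0.
have [m0 m0E] : exists m : S, forall x y : S, G (x, y) -> y = m * x.
  by apply: linear_on_graph => // y Gy; have [_ _ + _ _] := Gq _ _ Gy Gy; exact.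
have [G0 Gl'] := Gsub.
have Gl (s x y x' y' : S) : G (x, y) -> G (x', y') -> G (x * s + x', y * s + y').
  exact: Gl'.
have [||e [ee he eA ess]] := @essential_hull h (fun x => G (x, m0 * x)) hh.
- split; first by rewrite mulr0.
  by move=> s x y Gx Gy; rewrite mulrDr mulrA; exact: Gl.
- by move=> a Ga; have [] := Gq _ _ Ga Ga.
pose u := k * m0 * e.
have ue : u * e = u by rewrite -mulrA ee.
have uA x : G (x, m0 * x) -> u * x = m0 * x.
  by move=> Gx; rewrite -!mulrA eA //; have [] := Gq _ _ Gx Gx.
have uE x : u * (e * x) = u * x by rewrite mulrA ue.
have u_inj s : u * s = 0 -> e * s = 0.
  move=> us0; apply: (ess _) => r Gr; have [_ _ _ + _] := Gq _ _ Gr Gr; apply => /=.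
  by rewrite -uA // -(mulrA e) uE mulrA us0 mul0r.
(* Essentiality is used twice, to bring first [e s r] and then [e (t r) r'] into the domain. Then
   [e s r r'] lies in both the domain and the image, so it is zero. *)
have disj s t : e * s = u * t -> e * s = 0.
  move=> es_ut; apply: (ess _) => r Gr.
  suff etr0 : e * (t * r) = 0 by rewrite es_ut -mulrA -uE etr0 mulr0.
  apply: (ess _) => r' Gr'.
  have utE : u * (e * (t * r) * r') = e * s * r * r'.
    by rewrite -(mulrA e) uE !mulrA -es_ut.
  have Grr' : G (e * s * r * r', m0 * (e * s * r * r')).
    have := Gl r' _ _ _ _ Gr G0; rewrite /= !addr0.
    by rewrite -(mulrA m0).
  have [_ _ _ _ /= ] := Gq _ _ Grr' Gr'.
  rewrite -uA // utE => /(_ erefl) esrr'0.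
  by rewrite -(mulrA e); apply: u_inj; rewrite -uE (mulrA e) utE.
have ku : k * u = u by rewrite /u !mulrA kk.
clearbody u; exists e, u; split; first by split.
split=> // x y hx ky xy indep.
have e_u a : e * a = 0 -> u * a = 0 by rewrite -uE => ->; rewrite mulr0.
(* The map [e a |-> u a] extended by [x c |-> y c] has a graph containing [G]. Maximality puts [x]
   in the domain of [G], hence in [e S], and independence then gives [x = 0]. *)
have Gxy : G (x, y).
  apply: (Gmax (fun p => exists a c : S, p = (e * a + x * c, u * a + y * c))).
  - split; first by exists 0, 0; rewrite !mulr0 addr0.
    move=> s _ _ [a [c ->]] [a' [c' ->]]; exists (a * s + a'), (c * s + c').
    congr (_, _); [transitivity ((e * a + x * c) * s + (e * a' + x * c')) => //
      | transitivity ((u * a + y * c) * s + (u * a' + y * c')) => //];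
    by rewrite mulrDl !mulrDr !mulrA !addrA; congr (_ + _);
       rewrite -!addrA; congr (_ + _); rewrite addrC.
  - move=> _ _ [a [c ->]] [b [d ->]]; split=> /=.
    + by rewrite mulrDr !mulrA he hx.
    + by rewrite mulrDr !mulrA ku ky.
    + move=> z0; have [|xc0 _] := indep a 0 c 0; first by rewrite !mulr0 !addr0.
      by move: z0; rewrite xc0 addr0 => /e_u ->; rewrite add0r; exact/xy.
    + move=> z0; have [|_ yc0] := indep 0 a 0 c.
        by rewrite !mulr0 addr0 add0r.
      by move: z0; rewrite yc0 addr0 => /u_inj ->; rewrite add0r; exact/xy.
    + move=> z0; have [|xc0] := indep a (- b) c (- d).
        by rewrite !mulrN (addrAC (e * a)) z0 (addrAC (u * b)) subrr add0r subrr.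
      rewrite mulrN => /eqP; rewrite oppr_eq0 => /eqP yd0.
      by move: z0; rewrite xc0 yd0 !addr0; exact: disj.
  - move=> [x' y'] Gp; exists x', 0; rewrite !mulr0 !addr0.
    have y'E := m0E _ _ Gp; rewrite y'E in Gp *.
    by rewrite uA ?eA.
  by exists 0, 1; rewrite !mulr0 !mulr1 !add0r.
have := Gxy; rewrite (m0E _ _ Gxy) => Gx.
have [|] := indep x 0 (- 1) 0.
  by rewrite !mulr0 !addr0 eA // mulrN1 subrr.
by rewrite mulrN1 => /eqP; rewrite oppr_eq0 => /eqP.
Qed.

(** Left multiplication by [z] maps [q S] to [p S]. By regularity it restricts to an isomorphism
    from [q w z w S] onto [z w S = z S]. *)
Lemma eq0_of_no_partial_iso (p q z : S) : q * q = q -> p * z = z -> z * q = z ->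
  (forall x y, p * x = x -> q * y = y -> (forall s, x * s = 0 <-> y * s = 0) ->
     x = 0) -> z = 0.
Proof.
move=> qq pz zq no_iso; have [w zwz] := S_regular z.
rewrite -zwz (no_iso (z * w) (q * w * z * w)) ?mul0r //.
- by rewrite mulrA pz.
- by rewrite !mulrA qq.
move=> s; split=> [zws0|]; first by rewrite -!mulrA (mulrA z) zws0 !mulr0.
move/(congr1 (fun t => z * t)); rewrite mulr0 !mulrA zq => <-.
by rewrite zwz.
Qed.

(** The hypothesis is [c S (1 - c) = 0]. Each [y] in [(1 - c) S c] then satisfies [y S y = 0], so
    [y = 0] by regularity. *)
Lemma idempotent_central (c : S) : (forall s, c * s = c * s * c) ->
  forall s, c * s = s * c.
Proof.
move=> cE s; have [w] := S_regular ((1 - c) * s * c).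
have -> : (1 - c) * s * c * w * ((1 - c) * s * c) = 0.
  have cw0 : c * (w * (1 - c)) = 0.
    have cc : c * c = c by have := cE 1; rewrite mulr1.
    by rewrite cE -!mulrA mulrBl mul1r cc subrr !mulr0.
  have -> : (1 - c) * s * c * w * ((1 - c) * s * c) =
            (1 - c) * s * (c * (w * (1 - c))) * s * c by rewrite !mulrA.
  by rewrite cw0 mulr0 !mul0r.
by rewrite mulrBl mul1r mulrBl -cE => /esym/eqP; rewrite subr_eq0 => /eqP.
Qed.

(** Quantifying over additively closed [Q] expresses that [1 - c] is in the ideal [S z S] without
    writing a finite sum. *)
Lemma abelian_splitting : exists c e z : S,
  [/\ c * c = c, forall s, c * s = s * c,
      forall p, p * p = p -> c * p = p -> forall s, p * s = s * p
    & [/\ e * e = e, e * z = 0, z * e = z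
        & forall Q : S -> Prop, (forall x y, Q x -> Q y -> Q (x + y)) ->
            (forall a b, Q (a * z * b)) -> Q (1 - c)]].
Proof.
have [e [u [[ee _ _ ue] [u_inj disj max]]]] :=
  exists_maximal_partial_iso (mul1r 1) (mul1r 1).
(* [z] is the component of [u] in [(1 - e) S]; it stays injective on [e S] because [u S] meets [e S]
   only in [0]. *)
pose z := (1 - e) * u; pose e' := 1 - e.
have ee' : e * e' = 0 by rewrite mulrBr mulr1 ee subrr.
have e'e : e' * e = 0 by rewrite mulrBl mul1r ee subrr.
have zE : z = e' * u by [].
have ze : z * e = z by rewrite /z -mulrA ue.
have ez : e * z = 0 by rewrite zE mulrA ee' mul0r.
have uE : u = e * u + z by rewrite /z mulrBl mul1r addrC subrK.
have z_inj s : z * s = 0 -> e * s = 0.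
  move=> zs0; have us : e * (u * s) = u * s.
    by rewrite {2}uE mulrDl zs0 addr0 mulrA.
  by apply: u_inj; rewrite -us; exact: disj us.
clearbody z; have [w zwz] := S_regular z.
have ewz : e * w * z = e.
  apply/eqP; rewrite -subr_eq0 -{2}(mulr1 e) -mulrA -mulrBr; apply/eqP/z_inj.
  by rewrite mulrBr mulr1 mulrA zwz subrr.
pose v := e * w * e'.
have e'z : e' * z = z by rewrite mulrBl mul1r ez subr0.
have vz : v * z = e by rewrite -!mulrA e'z mulrA.
have ev : e * v = v by rewrite !mulrA ee.
have ve : v * e = 0 by rewrite -mulrA e'e mulr0.
(* [v] inverts [z] on [e S], so [f] is an idempotent orthogonal to [e] with [f S] isomorphic to
   [e S]. *)
clearbody v; pose f := z * v.
have ef : e * f = 0 by rewrite mulrA ez mul0r.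
have fe : f * e = 0 by rewrite -mulrA ve mulr0.
have fz : f * z = z by rewrite -mulrA vz ze.
have ff : f * f = f by rewrite {2}/f mulrA fz.
pose h := 1 - e - f.
have he : h * e = 0 by rewrite !mulrBl mul1r ee fe subrr subr0.
have eh : e * h = 0 by rewrite !mulrBr mulr1 ee ef subrr subr0.
have hf : h * f = 0 by rewrite !mulrBl mul1r ff ef subr0 subrr.
have hz : h * z = 0 by rewrite -fz mulrA hf mul0r.
have hh : h * h = h by rewrite {2}/h !mulrBr mulr1 he hf !subr0.
have efh : e + f + h = 1 by rewrite addrC /h -(addrA 1) -opprD subrK.
have fE : f = z * v by [].
(* As [h] kills [e S] and [u S], maximality now excludes nonzero isomorphic independent right ideals
   in [h S]. *)
clearbody f h; have {}max x y : h * x = x -> h * y = y ->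
    (forall s, x * s = 0 <-> y * s = 0) ->
    (forall c d, x * c + y * d = 0 -> x * c = 0 /\ y * d = 0) -> x = 0.
  move=> hx hy xy indep; apply: (max x y) => //; rewrite ?mul1r // => a b c d.
  move/(congr1 (fun t => h * t)); rewrite uE mulr0 !(mulrDr, mulrDl) !mulrA.
  by rewrite he hz hx hy !mul0r !add0r; exact: indep.
have [g [t [[gg hg et tg] [t_inj _ max']]]] :=
  exists_maximal_partial_iso hh ee.
(* [h1 S = g S], but [h1] also satisfies [h1 h = h1], which makes [h - h1] idempotent. [u1] embeds
   [h1 S] into [e S]. *)
pose h1 := g * h; pose u1 := t * h.
have h1h1 : h1 * h1 = h1 by rewrite /h1 mulrA -(mulrA g) hg gg.
have hh1 : h * h1 = h1 by rewrite /h1 mulrA hg.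
have h1h : h1 * h = h1 by rewrite /h1 -mulrA hh.
have h1g : h1 * g = g by rewrite /h1 -mulrA hg gg.
have h1e : h1 * e = 0 by rewrite /h1 -mulrA he mulr0.
have eu1 : e * u1 = u1 by rewrite /u1 mulrA et.
have u1h1 : u1 * h1 = u1 by rewrite /u1 -mulrA hh1 /h1 mulrA tg.
have u1g : u1 * g = t by rewrite /u1 -mulrA hg tg.
have u1_inj s : u1 * s = 0 -> h1 * s = 0.
  by rewrite /u1 /h1 -!mulrA; exact: t_inj.
clearbody u1 h1; have [w1 u1w1u1] := S_regular u1.
pose v1 := h1 * w1 * e.
have v1u1 : v1 * u1 = h1.
  rewrite /v1 -mulrA eu1; apply/eqP; rewrite -subr_eq0 -{2}(mulr1 h1) -mulrA.
  rewrite -mulrBr; apply/eqP/u1_inj.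
  by rewrite mulrBr mulr1 mulrA u1w1u1 subrr.
have h1v1 : h1 * v1 = v1 by rewrite /v1 !mulrA h1h1.
have v1e : v1 * e = v1 by rewrite /v1 -mulrA ee.
(* [e2 S] complements the image [u1 S] in [e S]. *)
clearbody v1; pose e2 := e - u1 * v1; pose c := h - h1.
have hE : h = c + h1 by rewrite subrK.
have e2E : e2 = e - u1 * v1 by [].
have ch : c * h = c by rewrite mulrBl hh h1h.
have hc : h * c = c by rewrite mulrBr hh hh1.
have cc : c * c = c by rewrite {2}/c mulrBr ch mulrBl hh1 h1h1 subrr subr0.
have ch1 : c * h1 = 0 by rewrite mulrBl hh1 h1h1 subrr.
have ce : c * e = 0 by rewrite mulrBl he h1e subrr.
have cg : c * g = 0 by rewrite mulrBl hg h1g subrr.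
have ct : c * t = 0 by rewrite -et mulrA ce mul0r.
have e2e : e2 * e = e2 by rewrite mulrBl ee -mulrA v1e.
have ee2 : e * e2 = e2 by rewrite mulrBr ee mulrA eu1.
have e2u1 : e2 * u1 = 0 by rewrite mulrBl eu1 -mulrA v1u1 u1h1 subrr.
have e2t : e2 * t = 0 by rewrite -u1g mulrA e2u1 mul0r.
have e2h : e2 * h = 0 by rewrite -e2e -mulrA eh mulr0.
have e2e2 : e2 * e2 = e2 by rewrite {2}/e2 mulrBr e2e mulrA e2u1 mul0r subr0.
have e2c : e2 * c = 0 by rewrite mulrBr e2h -h1h1 -hh1 !mulrA e2h !mul0r subr0.
clearbody e2 c.
(* An isomorphism between pieces of [c S] and [e2 S] would extend the maximal one from [g S] onto
   [t S]. *)
have c_e2 s : c * s * e2 = 0.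
  apply: (@eq0_of_no_partial_iso c e2) => //; rewrite ?mulrA ?cc // -?mulrA ?e2e2 //.
  move=> x y cx e2y xy; apply: (max' x y) => //.
  - by rewrite -cx mulrA hc.
  - by rewrite -e2y mulrA ee2.
  move=> a b p q0 sum0; split.
    move: (congr1 (fun t => c * t) sum0); rewrite mulr0 !mulrDr !mulrA cg ct cx.
    by rewrite -e2y mulrA -ee2 mulrA ce !mul0r !add0r addr0.
  move: (congr1 (fun t => e2 * t) sum0); rewrite mulr0 !mulrDr !mulrA e2y e2t.
  by rewrite -hg -cx !mulrA e2h e2c !mul0r !add0r.
(* [c S] and [h1 S] are independent in [h S], so the first maximality applies. *)
have c_h1 s : c * s * h1 = 0.
  apply: (@eq0_of_no_partial_iso c h1) => //; rewrite ?mulrA ?cc // -?mulrA ?h1h1 //.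
  move=> x y cx h1y xy; apply: (max x y) => //.
  - by rewrite -cx mulrA hc.
  - by rewrite -h1y mulrA hh1.
  move=> p q0 sum0; have xp0 : x * p = 0.
    move: (congr1 (fun t => c * t) sum0); rewrite mulr0 mulrDr !mulrA cx.
    by rewrite -h1y mulrA ch1 !mul0r addr0.
  by move: sum0; rewrite xp0 add0r.
have c_e s : c * s * e = 0.
  have -> : e = e2 + u1 * v1 by rewrite e2E subrK.
  by rewrite mulrDr c_e2 add0r -h1v1 !mulrA -(mulrA c) c_h1 mul0r.
have c_f s : c * s * f = 0.
  by rewrite fE -ze !mulrA -(mulrA c) c_e mul0r.
have cE : c = 1 - (e + f + h1).
  by rewrite -efh hE opprD addrACA subrr add0r addrK.
have c_center s : c * s = s * c.
  apply: idempotent_central => {}s.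
  by rewrite [X in _ = _ * X]cE mulrBr mulr1 !mulrDr c_e c_f c_h1 !addr0 subr0.
exists c, e, z; split=> //.
  (* The same maximality, applied to [p S] and [(c - p) S], gives [p S (1 - p) = 0]. *)
  move=> p pp cp; apply: idempotent_central => s.
  apply/eqP; rewrite -subr_eq0 -{1}cp -mulrA c_center -mulrBr; apply/eqP.
  have pcp : p * (c - p) = 0 by rewrite mulrBr -c_center cp pp subrr.
  have ccp : c * (c - p) = c - p by rewrite mulrBr cc cp.
  apply: (@eq0_of_no_partial_iso p (c - p)) => //.
  - by rewrite mulrBr -c_center ccp mulrBl cp pp subrr subr0.
  - by rewrite !mulrA pp.
  - by rewrite -!mulrA; congr (_ * (_ * _));
      rewrite mulrBr -c_center ccp mulrBl cp pp subrr subr0.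
  move=> x y px cpy xy; apply: (max x y) => //.
  - by rewrite -px -cp !mulrA hc.
  - by rewrite -cpy -ccp !mulrA hc.
  move=> a b sum0; have xa0 : x * a = 0.
    move: (congr1 (fun t => p * t) sum0); rewrite mulr0 mulrDr !mulrA px.
    by rewrite -cpy mulrA pcp !mul0r addr0.
  by move: sum0; rewrite xa0 add0r.
(* [1 - c = e + f + h1], where [e = e w z], [f = z v] and [h1 = v1 e u1] all lie in [S z S]. *)
split=> // Q QD Qz; rewrite cE opprB addrC subrK.
have Qe a b : Q (a * e * b).
  by rewrite -ewz !mulrA; exact: Qz.
apply: (QD (e + f)); first apply: (QD e f).
- by have := Qe 1 1; rewrite mulr1 mul1r.
- by rewrite fE -(mul1r z).
- by rewrite -v1u1 -v1e.
Qed.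
End RegularSelfInjective.

(** * Corner rings at central idempotents *)

Section Corner.

Record central_idempotent (A : pzRingType) := CentralIdempotent {
  central_idempotent_val :> A;
  central_idempotentK : central_idempotent_val * central_idempotent_val =
    central_idempotent_val;
  central_idempotentC : forall x, central_idempotent_val * x =
    x * central_idempotent_val }.

Variables (A : pzRingType) (c : central_idempotent A).

Definition corner_pred : {pred A} := fun x => (c : A) * x == x.

Fact corner_zmod_closed : zmod_closed corner_pred.
Proof.
split=> [|x y]; rewrite !unfold_in ?mulr0 // => /eqP cx /eqP cy.
by rewrite mulrBr cx cy.
Qed.
HB.instance Definition _ := GRing.isZmodClosed.Build _ corner_pred
  corner_zmod_closed.

Record corner := Corner { corner_val : A; _ : corner_val \in corner_pred }.
HB.instance Definition _ := [isSub for corner_val].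
HB.instance Definition _ := [Choice of corner by <:].
HB.instance Definition _ := [SubChoice_isSubZmodule of corner by <:].

Lemma cornerE (x : corner) : (c : A) * val x = val x.
Proof. by case: x => x /= /eqP. Qed.

Fact corner_proj_subproof (s : A) : (c : A) * s \in corner_pred.
Proof. by rewrite unfold_in mulrA central_idempotentK. Qed.
Definition corner_proj s := Corner (corner_proj_subproof s).

Definition corner_mul (x y : corner) := corner_proj (val x * val y).
Definition corner_one := corner_proj 1.

Lemma corner_mulE (x y : corner) : val (corner_mul x y) = val x * val y.
Proof. by rewrite /= mulrA cornerE. Qed.

Fact corner_mulA : associative corner_mul.
Proof. by move=> x y z; apply/val_inj; rewrite !corner_mulE mulrA. Qed.
Fact corner_mul1 : left_id corner_one corner_mul.
Proof.
move=> x; apply/val_inj.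
by rewrite /= mulr1 !mulrA central_idempotentK cornerE.
Qed.
Fact corner_mulr1 : right_id corner_one corner_mul.
Proof.
move=> x; apply/val_inj.
by rewrite /= mulr1 -central_idempotentC mulrA central_idempotentK cornerE.
Qed.
Fact corner_mulDl : left_distributive corner_mul +%R.
Proof. by move=> x y z; apply/val_inj; rewrite /= mulrDl mulrDr. Qed.
Fact corner_mulDr : right_distributive corner_mul +%R.
Proof. by move=> x y z; apply/val_inj; rewrite /= !mulrDr. Qed.
HB.instance Definition _ := GRing.Zmodule_isPzRing.Build corner corner_mulA
  corner_mul1 corner_mulr1 corner_mulDl corner_mulDr.

Lemma corner_valM (x y : corner) : val (x * y) = val x * val y.
Proof. exact: corner_mulE. Qed.

Lemma corner_val1 : val (1 : corner) = c.
Proof. exact: mulr1. Qed.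

Lemma corner_projK (x : corner) : corner_proj (val x) = x.
Proof. by apply/val_inj; rewrite /= cornerE. Qed.

Fact corner_proj_additive : zmod_morphism corner_proj.
Proof. by move=> x y; apply/val_inj; rewrite /= mulrBr. Qed.
Fact corner_proj_monoid : monoid_morphism corner_proj.
Proof.
split=> [|x y]; apply/val_inj => //; rewrite corner_valM /=.
by rewrite -[RHS]mulrA (mulrA x) -central_idempotentC !mulrA central_idempotentK.
Qed.
HB.instance Definition _ := GRing.isZmodMorphism.Build A corner corner_proj
  corner_proj_additive.
HB.instance Definition _ := GRing.isMonoidMorphism.Build A corner corner_proj
  corner_proj_monoid.

Lemma corner_val_mul_proj (x : corner) (s : A) :
  val (x * corner_proj s) = val x * s.
Proof. by rewrite corner_valM /= mulrA -(central_idempotentC c (val x)) cornerE. Qed.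

Lemma corner_regular : von_neumann_regular A -> von_neumann_regular corner.
Proof.
move=> regA a; have [x axa] := regA (val a); exists (corner_proj x); apply/val_inj.
by rewrite !corner_valM /= mulrA -(central_idempotentC c (val a)) cornerE.
Qed.

Section RestrictScalars.
Variable U : lmodType corner^c.

(* [A] acts on [U] through the projection [a |-> c * a]. *)
Definition restrict_scalars : Type := U.
HB.instance Definition _ := GRing.Zmodule.on restrict_scalars.

Let scale (s : A^c) (u : restrict_scalars) : restrict_scalars :=
  (corner_proj s : corner^c) *: (u : U).

Fact restrict_scalarsA (a b : A^c) v : scale a (scale b v) = scale (a * b) v.
Proof.
by rewrite /scale scalerA; congr (_ *: _); rewrite [RHS](rmorphM corner_proj).
Qed.
Fact restrict_scalars1 : left_id 1 scale.
Proof. by move=> v; rewrite /scale [corner_proj _](rmorph1 corner_proj) scale1r. Qed.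
Fact restrict_scalarsDr : right_distributive scale +%R.
Proof. by move=> a u v; rewrite /scale scalerDr. Qed.
Fact restrict_scalarsDl v : {morph scale^~ v : a b / a + b}.
Proof.
by move=> a b; rewrite /scale [corner_proj _](rmorphD corner_proj) scalerDl.
Qed.
HB.instance Definition _ := GRing.Zmodule_isLmodule.Build A^c restrict_scalars
  restrict_scalarsA restrict_scalars1 restrict_scalarsDr restrict_scalarsDl.

Lemma restrict_scalarsE (s : A) (u : restrict_scalars) :
  (s : A^c) *: u = (corner_proj s : corner^c) *: (u : U).
Proof. by []. Qed.
End RestrictScalars.

(** Restriction of scalars turns a diagram over the corner into one over [A]. The map composed with
    the inclusion into [A] extends by injectivity, and multiplication by [c] brings the extension
    back into the corner. *)
Lemma corner_self_injective : right_self_injective A -> right_self_injective corner.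
Proof.
move=> injA U V i f inj_i.
pose U' : lmodType A^c := restrict_scalars U.
pose V' : lmodType A^c := restrict_scalars V.
have i'P : linear (i : U' -> V').
  by move=> a x y; rewrite !restrict_scalarsE [LHS]linearP.
have f'P : linear (fun u : U' => val (f u : corner) : (A^c)^o).
  move=> a x y; rewrite restrict_scalarsE.
  rewrite [f _]linearP.
  transitivity (val ((f x : corner) * corner_proj a) + val (f y : corner)) => //.
  by rewrite corner_val_mul_proj.
pose i' : {linear U' -> V'} := HB.pack (i : U' -> V')
  (GRing.isLinear.Build _ _ _ _ _ i'P).
pose f' : {linear U' -> (A^c)^o} := HB.pack
  (fun u : U' => val (f u : corner) : (A^c)^o) (GRing.isLinear.Build _ _ _ _ _ f'P).
have [g' g'E] := injA U' V' i' f' inj_i.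
pose g (v : V) : (corner^c)^o := corner_proj (g' v).
have gP : linear g.
  move=> a x y; have aE : a *: x = (val (a : corner) : A^c) *: (x : V') :> V.
    by rewrite restrict_scalarsE corner_projK.
  rewrite /g aE [g' _]linearP.
  transitivity (corner_proj ((g' x : A) * val (a : corner) + (g' y : A))) => //.
  by rewrite rmorphD rmorphM /= corner_projK.
pose g0 : {linear V -> (corner^c)^o} := HB.pack g
  (GRing.isLinear.Build _ _ _ _ _ gP).
exists g0 => u.
by transitivity (corner_proj (val (f u : corner)));
  [congr corner_proj; exact: g'E | exact: corner_projK].
Qed.
End Corner.

(** * Subrings containing all units *)

Section UnitClosedSubring.
Variables (S : pzRingType) (Q : S -> Prop).
Hypothesis QD : forall x y, Q x -> Q y -> Q (x + y).
Hypothesis QM : forall x y, Q x -> Q y -> Q (x * y).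
Hypothesis Q_unit : forall u, is_unit u -> Q u.

(** [1 + x] has inverse [1 - x], so [x] is the sum of the units [1 + x] and [- 1]. *)
Lemma subring_square_zero x : x * x = 0 -> Q x.
Proof.
have unitN1 : is_unit (- 1 : S) by exists (- 1); rewrite mulrNN mulr1.
move=> xx0; rewrite -(addKr 1 x) addrC; apply: (QD _ (Q_unit unitN1)).
apply: Q_unit; exists (1 - x); rewrite mulrBr mulr1 mulrDl mul1r xx0 addr0 addrK.
by split; rewrite // mulrDr mulr1 mulrBl mul1r xx0 subr0 subrK.
Qed.

(* In the Peirce decomposition with respect to [e], the off-diagonal parts of
   [a z b] have square zero, and its diagonal parts are products of two
   off-diagonal elements. *)
Lemma subring_peirce_ideal e z : e * e = e -> e * z = 0 -> z * e = z ->
  forall a b, Q (a * z * b).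
Proof.
move=> ee ez ze a b; pose f := 1 - e.
have ef : e * f = 0 by rewrite mulrBr mulr1 ee subrr.
have fe : f * e = 0 by rewrite mulrBl mul1r ee subrr.
have fz : f * z = z by rewrite mulrBl mul1r ez subr0.
have f_e s : Q (f * s * e).
  by apply: subring_square_zero; rewrite -!mulrA (mulrA e f) ef mul0r !mulr0.
have e_f s : Q (e * s * f).
  by apply: subring_square_zero; rewrite -!mulrA (mulrA f e) fe mul0r !mulr0.
have -> : a * z * b = (e * (a * z * b) * f + f * (a * z * b) * e) +
    ((e * a * f) * (f * (z * b) * e) + (f * (a * z) * e) * (e * b * f)).
  have -> : (e * a * f) * (f * (z * b) * e) = e * (a * z * b) * e.
    by rewrite -!mulrA (mulrA f z) fz (mulrA f z) fz !mulrA.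
  have -> : (f * (a * z) * e) * (e * b * f) = f * (a * z * b) * f.
    by rewrite !mulrA -(mulrA _ e e) ee -(mulrA _ z e) ze.
  set t := a * z * b; have ef1 : 1 = e + f by rewrite addrC subrK.
  rewrite -[LHS]mul1r -[LHS]mulr1 ef1 mulrDl mulrDr !mulrDl.
  by rewrite addrACA [RHS]addrACA (addrC (e * t * e)).
by apply: QD; apply: QD => //; apply: QM.
Qed.
End UnitClosedSubring.

(** With [w] in [c S], the idempotents [a w] and [w a] are central, hence equal to one [p]. So [a]
    and [w p] are inverse in [p S], and [w p + (1 - p)] is a unit with inverse [a + (1 - p)]. *)
Lemma unit_regular_of_central_idempotents (S : pzRingType) (c a : S) :
  von_neumann_regular S -> (forall s, c * s = s * c) -> c * c = c -> c * a = a ->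
  (forall p, p * p = p -> c * p = p -> forall s, p * s = s * p) ->
  exists u, is_unit u /\ a * u * a = a.
Proof.
move=> S_regular c_center cc ca c_abelian; have [w0 aw0a] := S_regular a.
pose w := c * w0; have cw : c * w = w by rewrite mulrA cc.
have awa : a * w * a = a by rewrite /w (mulrA a) -c_center ca.
clearbody w; pose p := a * w; pose p' := w * a.
have pC s : p * s = s * p.
  by apply: c_abelian; rewrite ?mulrA ?ca // awa.
have p'C s : p' * s = s * p'.
  by apply: c_abelian; rewrite ?mulrA ?cw // -!(mulrA w) awa.
have p_p' : p * p' = p' by rewrite mulrA pC -mulrA mulrA -mulrA awa.
have p'_p : p' * p = p by rewrite mulrA p'C mulrA awa.
have pp' : p' = p by rewrite -p_p' pC p'_p.
have pa : p * a = a by [].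
have wa : w * a = p := pp'.
have pp : p * p = p by rewrite -{1}pp' p'_p.
have aw : a * w = p by [].
clearbody p p'; exists (w * p + (1 - p)).
have ya : w * p * a = p by rewrite -mulrA pa.
have ay : a * (w * p) = p by rewrite mulrA aw.
have qa : (1 - p) * a = 0 by rewrite mulrBl mul1r pa subrr.
have aq : a * (1 - p) = 0 by rewrite mulrBr mulr1 -pC pa subrr.
have qq : (1 - p) * (1 - p) = 1 - p.
  by rewrite mulrBr mulr1 mulrBl mul1r pp subrr subr0.
have yq : w * p * (1 - p) = 0 by rewrite mulrBr mulr1 -mulrA pp subrr.
have qy : (1 - p) * (w * p) = 0.
  by rewrite mulrBl mul1r (pC (w * p)) -mulrA pp subrr.
have : p + (1 - p) = 1 by rewrite addrC subrK.
move: (1 - p) qa aq qq yq qy => q qa aq qq yq qy pq1.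
split; last by rewrite mulrDr ay aq addr0 pa.
exists (a + q); split.
  by rewrite mulrDr !mulrDl ya qa yq qq addr0 add0r.
by rewrite mulrDr !mulrDl ay aq qy qq addr0 add0r.
Qed.

(** * Regularity and decomposition of the stable subring *)

Theorem theorem2p4 (S : pzRingType) (P : pred S) (R : subPzRingType P)
    (S_regular : von_neumann_regular S)
    (S_injective : right_self_injective S)
    (R_stable : forall (u : S) (r : R), is_unit u -> P (u * val r)) :
  von_neumann_regular R /\
  exists (R1 R2 : pzRingType) (phi : {rmorphism (R1 * R2)%type -> R}),
    [/\ bijective phi,
        abelian_regular R1,
        von_neumann_regular R2,
        right_self_injective R2
      & forall (s : S) (r : R2), exists r' : R2,
          s * val (phi (0, r)) = val (phi (0, r'))].
Proof.
have P_unit u : is_unit u -> P u.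
  by move=> /(R_stable u 1); rewrite rmorph1 mulr1.
have PD x y : P x -> P y -> P (x + y).
  move=> Px Py; rewrite -(SubK R Px) -(SubK R Py) -rmorphD; exact: valP.
have PM x y : P x -> P y -> P (x * y).
  move=> Px Py; rewrite -(SubK R Px) -(SubK R Py) -rmorphM; exact: valP.
have [c [e [z [cc c_center c_abelian [ee ez ze g_ideal]]]]] :=
  abelian_splitting S_regular S_injective.
have Pz := subring_peirce_ideal PD PM P_unit ee ez ze.
pose g := 1 - c.
(* [g] is a sum of terms [a z b], and [R] contains every [a z b s]. *)
have Pg s : P (g * s).
  apply: (g_ideal (fun x => P (x * s))) => [x y Px Py|a b].
    by rewrite mulrDl; exact: PD.
  by rewrite -mulrA.
have gg : g * g = g by rewrite mulrBr mulr1 mulrBl mul1r cc subrr subr0.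
have g_center s : g * s = s * g by rewrite mulrBl mulrBr mul1r mulr1 c_center.
have cg1 : c + g = 1 by rewrite addrC subrK.
have cg0 : c * g = 0 by rewrite mulrBr mulr1 cc subrr.
have gc0 : g * c = 0 by rewrite g_center.
have Pc : P c.
  have PN1 : P (- 1) by apply: P_unit; exists (- 1); rewrite mulrNN mulr1.
  have P1 : P 1 by apply: P_unit; exists 1; rewrite mulr1.
  have -> : c = -1 * (-1 + g * 1).
    by rewrite mulr1 mulN1r opprD opprK opprB addrC subrK.
  by apply: PM => //; apply: PD.
have R_regular : von_neumann_regular R.
  move=> r; have [|u [u_unit aua]] := @unit_regular_of_central_idempotents S c
    (c * val r) S_regular c_center cc _ c_abelian; first by rewrite mulrA cc.
  have [w rwr] := S_regular (val r).
  (* The unit [u] is in [R]; [w] need not be, but [g w] is. *)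
  have Px : P (c * u + g * w) by apply: PD => //; apply: PM => //; exact: P_unit.
  exists (Sub _ Px); apply/val_inj; rewrite !rmorphM /= SubK.
  set x := val r in rwr aua *.
  rewrite mulrDr mulrDl.
  have -> : x * (c * u) * x = c * x.
    rewrite -[RHS]aua !mulrA -(mulrA (c * x * u)) -(c_center x) !mulrA.
    by rewrite -!c_center !mulrA cc.
  have -> : x * (g * w) * x = g * x.
    by rewrite (mulrA x) -g_center -!mulrA (mulrA x) rwr.
  by rewrite -mulrDl cg1 mul1r.
split=> //.
have cRK : Sub c Pc * Sub c Pc = Sub c Pc :> R.
  by apply/val_inj; rewrite rmorphM /= !SubK.
have cRC x : Sub c Pc * x = x * Sub c Pc :> R.
  by apply/val_inj; rewrite !rmorphM /= !SubK.
pose cR := CentralIdempotent cRK cRC.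
pose gS := CentralIdempotent gg g_center.
pose R1 : pzRingType := corner cR.
(* [R2] is taken as a corner of [S], so that it inherits regularity and self-injectivity from [S];
   it lies in [R] because [g S] does. *)
pose R2 : pzRingType := corner gS.
have val1 (a : R1) : c * val (val a) = val (val a).
  by rewrite -[in RHS](cornerE a) rmorphM /= SubK.
have val2 (b : R2) : g * val b = val b := cornerE b.
have P2 (b : R2) : P (val b) by rewrite -val2.
have val12 (a : R1) (b : R2) : val (val a) * val b = 0.
  by rewrite -val1 c_center -mulrA -val2 (mulrA c) cg0 mul0r mulr0.
have val21 (a : R1) (b : R2) : val b * val (val a) = 0.
  by rewrite -val2 g_center -mulrA -val1 (mulrA g) gc0 mul0r mulr0.
pose phi0 (p : (R1 * R2)%type) : R := val p.1 + Sub (val p.2) (P2 p.2).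
have phi0E p : val (phi0 p) = val (val p.1) + val p.2.
  by rewrite rmorphD /= SubK.
have phi0B : zmod_morphism phi0.
  move=> p q; apply/val_inj; rewrite rmorphB /= !phi0E /= !raddfB /=.
  by rewrite opprD addrACA.
have phi0M : monoid_morphism phi0.
  split=> [|p q]; apply/val_inj.
    rewrite [RHS]rmorph1 phi0E;
    transitivity (val (val (1 : R1)) + val (1 : R2)) => //.
    by rewrite !corner_val1 SubK cg1.
  rewrite [RHS]rmorphM /= !phi0E.
  transitivity (val (val (p.1 * q.1)) + val (p.2 * q.2)) => //.
  by rewrite !corner_valM rmorphM /= mulrDl !mulrDr val12 val21 addr0 add0r.
pose phi : {rmorphism (R1 * R2)%type -> R} := HB.pack phi0
  (GRing.isZmodMorphism.Build _ _ phi0 phi0B)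
  (GRing.isMonoidMorphism.Build _ _ phi0 phi0M).
exists R1, R2, phi; split.
- exists (fun r => (corner_proj cR r, corner_proj gS (val r))).
    move=> p; have pE : val (phi p) = val (val p.1) + val p.2 := phi0E p.
    rewrite [RHS]surjective_pairing; congr (_, _); apply/val_inj => /=.
      apply/val_inj; rewrite rmorphM /= SubK pE mulrDr val1.
      by rewrite -val2 mulrA cg0 mul0r addr0.
    by rewrite pE mulrDr val2 -val1 mulrA gc0 mul0r add0r.
  move=> r; apply/val_inj; rewrite [LHS]phi0E /= rmorphM /= SubK.
  by rewrite -mulrDl cg1 mul1r.
- split=> [|p pp x]; first exact: corner_regular.
  have pP : val (val p) * val (val p) = val (val p).
    by rewrite -rmorphM -corner_valM pp.
  apply/val_inj; rewrite !corner_valM; apply/val_inj; rewrite !rmorphM /=.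
  by apply: c_abelian; rewrite ?val1.
- exact: corner_regular.
- exact: corner_self_injective.
- have phi2 b : val (phi (0, b)) = val b by rewrite [LHS]phi0E /= !raddf0 add0r.
  move=> s b; exists (corner_proj gS (s * val b)).
  by rewrite !phi2 /= mulrA g_center -mulrA val2.
Qed.
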